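(* Let $M$ be a differentiable manifold, $X$ a fixed $C^1$ vector field, $D_X$ an $S$-derivation along $X$, and $x_0\in M$. If there is a local basis of vector fields, defined in a neighborhood of $x_0$, in which the components of $D_X$ vanish at $x_0$, then there exist holonomic local bases, defined in a neighborhood of $x_0$, in which the components of $D_X$ vanish at $x_0$.
   Context: $n=\dim M$; latin indices run from $1$ to $n$ and repeated indices on different levels are summed. $S$-derivation: let $S:X\mapsto S_X$ be a map (no linearity is assumed) from $C^1$ vector fields to tensor fields of type $(1,1)$. For each $X$ the formula $D_X=L_X+S_X$ defines a derivation of the tensor algebra over $M$, where $L_X$ is the Lie derivative along $X$ and $S_X$ acts as the algebraic derivation induced by the endomorphism field $S_X$ (so $S_X f=0$ on functions and $S_X Y=S_X(Y)$ on vector fields). $D_X$ is called an $S$-derivation along $X$. Components: in a local basis (frame) $\{E_i\}$ of $C^1$ vector fields (not necessarily a coordinate one), the components of $D_X$ are the functions $(W_X)^i_{.j}$ defined by $D_X(E_j)=(W_X)^i_{.j}E_i$. A local basis $\{E_i\}$ is holonomic if its vectors commute, $[E_i,E_j]=0$ for all $i,j$ in its domain (equivalently, locally it is a coordinate basis). *)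

(* Defs.v *)
(* MathComp-Analysis; R is an arbitrary realType. *)
From mathcomp Require Import all_boot all_order all_algebra.
From mathcomp Require Import all_classical all_reals all_analysis.

Set Implicit Arguments.
Unset Strict Implicit.
Unset Printing Implicit Defensive.

Import Order.TTheory GRing.Theory Num.Theory.
Import numFieldNormedType.Exports.

Local Open Scope classical_set_scope.
Local Open Scope ring_scope.

Section Euclidean.
Variables (R : realType) (n : nat).
Implicit Types (f : 'rV[R]_n -> R) (V : set 'rV[R]_n).

Definition pderiv (k : 'I_n) f (y : 'rV[R]_n) : R := 'D_(delta_mx 0 k) f y.

(* f is of class C^r on V, for V open *)
Fixpoint is_C (r : nat) V f : Prop :=
  (forall y, V y -> {for y, continuous f}) /\
  if r is r'.+1 then
    forall k, (forall y, V y -> derivable f y (delta_mx 0 k)) /\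
              is_C r' V (pderiv k f)
  else True.

End Euclidean.

(* n-dimensional manifolds, given by an atlas. C^2 is the weakest regularity
   for which C^1 vector fields make sense; every atlas of class C^r with
   2 <= r <= oo satisfies mf_transition. Second countability is not required. *)
Record manifold (R : realType) (n : nat) := Manifold {
  mf_carrier :> topologicalType;
  mf_hausdorff : hausdorff_space mf_carrier;
  mf_chart : Type;
  mf_dom : mf_chart -> set mf_carrier;
  mf_coord : mf_chart -> mf_carrier -> 'rV[R]_n;
  mf_inv : mf_chart -> 'rV[R]_n -> mf_carrier;
  mf_cover : forall x, exists c, mf_dom c x;
  mf_dom_open : forall c, open (mf_dom c);
  mf_img_open : forall c, open (mf_coord c @` mf_dom c);
  mf_coordK : forall c x, mf_dom c x -> mf_inv c (mf_coord c x) = x;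
  mf_coord_continuous : forall c x, mf_dom c x ->
    {for x, continuous (mf_coord c)};
  mf_inv_continuous : forall c y, (mf_coord c @` mf_dom c) y ->
    {for y, continuous (mf_inv c)};
  mf_transition : forall c c' k,
    is_C 2 (mf_coord c @` (mf_dom c `&` mf_dom c'))
      (fun y => mf_coord c' (mf_inv c y) 0 k)
}.

Arguments mf_dom {R n} _ _.
Arguments mf_coord {R n} _ _ _.
Arguments mf_inv {R n} _ _ _.

Section Tensors.
Variables (R : realType) (n : nat) (M : manifold R n).
Local Notation chart := (mf_chart M).

(* f, a function on M, differentiated along the k-th coordinate of c *)
Definition cderiv (c : chart) (k : 'I_n) (f : M -> R) (x : M) : R :=
  pderiv k (f \o mf_inv M c) (mf_coord M c x).

(* d x'^k / d x^l, where x are the coordinates of c and x' those of c' *)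
Definition jac (c c' : chart) (x : M) (k l : 'I_n) : R :=
  cderiv c l (fun z => mf_coord M c' z 0 k) x.

(* families of components T^{a_1 .. a_p}_{b_1 .. b_q}, one for each chart *)
Definition components (p q : nat) :=
  chart -> M -> {ffun 'I_p -> 'I_n} -> {ffun 'I_q -> 'I_n} -> R.

(* Tensor fields of type (p,q) on an open set U, without any regularity. The
   components are only meaningful on U `&` mf_dom M c; they are set to 0
   elsewhere so that equal tensor fields are equal families. *)
Record tensor_field (p q : nat) (U : set M) := TensorField {
  tf_comp :> components p q;
  tf_out : forall c x a b, ~ (U `&` mf_dom M c) x -> tf_comp c x a b = 0;
  tf_change : forall c c' x a' b',
    U x -> mf_dom M c x -> mf_dom M c' x ->
    tf_comp c' x a' b' =
      \sum_(a : {ffun 'I_p -> 'I_n}) \sum_(b : {ffun 'I_q -> 'I_n})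
        (\prod_s jac c c' x (a' s) (a s)) *
        (\prod_t jac c' c x (b t) (b' t)) *
        tf_comp c x a b
}.

Definition is_C1 p q (U : set M) (T : components p q) : Prop :=
  forall c a b, is_C 1 (mf_coord M c @` (U `&` mf_dom M c))
    (fun y => T c (mf_inv M c y) a b).

Record C1_vector_field (U : set M) := C1VectorField {
  vf_field :> tensor_field 1 0 U;
  vf_C1 : is_C1 U vf_field
}.

(* Y^k; the second multi-index, a function on 'I_0, is the empty one *)
Definition vec_comp (Y : components 1 0) (c : chart) (k : 'I_n) (x : M) : R :=
  Y c x [ffun=> k] [ffun=> k].

(* A^i_j *)
Definition endo_comp (A : components 1 1) (c : chart) (i j : 'I_n) (x : M)
  : R := A c x [ffun=> i] [ffun=> j].

(* the multi-index a with its s-th index replaced by k *)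
Definition set_index m (a : {ffun 'I_m -> 'I_n}) (s : 'I_m) (k : 'I_n) :
  {ffun 'I_m -> 'I_n} := [ffun i => if i == s then k else a i].

Definition Lie p q (X : components 1 0) (T : components p q) :
    components p q := fun c x a b =>
  \sum_k vec_comp X c k x * cderiv c k (fun z => T c z a b) x
  - \sum_s \sum_k cderiv c k (vec_comp X c (a s)) x * T c x (set_index a s k) b
  + \sum_t \sum_k cderiv c (b t) (vec_comp X c k) x * T c x a (set_index b t k).

(* the derivation of the tensor algebra induced by an endomorphism field *)
Definition alg_der p q (A : components 1 1) (T : components p q) :
    components p q := fun c x a b =>
  \sum_s \sum_k endo_comp A c (a s) k x * T c x (set_index a s k) b
  - \sum_t \sum_k endo_comp A c k (b t) x * T c x a (set_index b t k).

Definition S_map := C1_vector_field setT -> tensor_field 1 1 setT.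

(* D_X = L_X + S_X *)
Definition S_derivation (S : S_map) (X : C1_vector_field setT) p q
    (T : components p q) : components p q :=
  fun c x a b => Lie X T c x a b + alg_der (S X) T c x a b.

Record local_basis := LocalBasis {
  lb_dom : set M;
  lb_open : open lb_dom;
  lb_vec :> 'I_n -> C1_vector_field lb_dom;
  lb_basis : forall c x, lb_dom x -> mf_dom M c x ->
    \matrix_(i, k) vec_comp (lb_vec i) c k x \in unitmx
}.

Definition holonomic (E : local_basis) : Prop :=
  forall i j c k x, lb_dom E x -> mf_dom M c x ->
    vec_comp (Lie (E i) (E j)) c k x = 0.

(* W x i j is (W_X)^i_j at x; these are determined on lb_dom E *)
Definition is_components_of (S : S_map) (X : C1_vector_field setT)
    (E : local_basis) (W : M -> 'M[R]_n) : Prop :=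
  forall j c k x, lb_dom E x -> mf_dom M c x ->
    vec_comp (S_derivation S X (E j)) c k x =
      \sum_i W x i j * vec_comp (E i) c k x.

Definition components_vanish_at (S : S_map) (X : C1_vector_field setT)
    (E : local_basis) (x0 : M) : Prop :=
  exists2 W, is_components_of S X E W & W x0 = 0.

End Tensors.

(* Main.v *)
From HB Require Import structures.
Require Import Defs.
From mathcomp Require Import all_boot all_order all_algebra.
From mathcomp Require Import all_classical all_reals all_analysis.
From mathcomp Require Import ring lra.

Set Implicit Arguments.
Unset Strict Implicit.
Unset Printing Implicit Defensive.

Import Order.TTheory GRing.Theory Num.Theory.
Import numFieldNormedType.Exports.

Local Open Scope classical_set_scope.
Local Open Scope ring_scope.

(** In a chart around [x0] put A = S_X - (dX^i/dx^j) at [x0]. The components of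
    D_X in a frame F vanish at [x0] exactly when

      X(F) + A F = 0   at [x0],                                          (E)

    F being the matrix whose columns are the vectors of the frame. The given
    frame is used only to rule out an obstruction: if X vanishes at [x0],
    (E) reads A F = 0, so that A = 0.

    A frame whose dual forms are closed is holonomic. Take as dual forms the
    rows of the matrix

      G(y) = 1 - sum_m (y - y0)^m B_m,     B_m = (B^i_lm)_il,

    with constant coefficients symmetric in l and m, so that the i-th row is
    the differential of y^i minus a quadratic form. No new coordinates, and no
    inverse function theorem, are needed: F = G^-1 is defined where G is
    invertible, and dF = - F (dG) F gives d_m F = F B_m F. Hence
    [F_i, F_j]^l = sum (F^m_i F^p_j - F^m_j F^p_i) F^l_q B^q_pm, which is 0 by
    the symmetry of B ([pderiv_frame]). At y0 one has F = 1 and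
    X(F) = sum_m X^m B_m, so (E) asks for a symmetric B whose contraction
    with X is - A. It exists by [symmetric_contraction]: if X is not 0, some
    covector xi has xi(X) = 1 and B can be written down from xi, A and A X; if
    X = 0 then A = 0 and B = 0 will do.

    All this takes place in one chart, while vector fields, brackets and the
    components of D_X are to be controlled in every chart. So it has to be
    shown that the bracket of two C^1 fields changes as a vector
    ([Lie_change]), hence so does D_X E_j ([S_derivation_change]), and that a
    field given by C^1 components in one chart is a C^1 vector field
    ([vector_field_of_chart]). These rest on calculus in R^n: a function with
    continuous partial derivatives is differentiable ([C1_differentiable]),
    which gives the chain rule, and second partial derivatives commute
    ([schwarz]), which makes the second derivatives of the change of
    coordinates cancel from the bracket. *)

(** * Functions with continuous partial derivatives *)

Section MeanValue.
Variables (R : realType) (V : normedModType R).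

Lemma is_derive_line (f : V -> R) (y v : V) (s : R) :
  derivable f (y + s *: v) v ->
  is_derive s 1 (fun u => f (y + u *: v)) ('D_v f (y + s *: v)).
Proof.
have E : (fun h : R => h^-1 *: (((fun u => f (y + u *: v)) \o shift s) (h *: 1)
            - f (y + s *: v)))
       = (fun h => h^-1 *: ((f \o shift (y + s *: v)) (h *: v)
            - f (y + s *: v))).
  apply/funext => h /=; congr (_ *: (f _ - _)).
  by rewrite [h *: 1]mulr1 scalerDl addrCA addrA.
by move=> df; split; rewrite /derivable /derive E.
Qed.

(** The increment [t] may have any sign, as the coordinates of a displacement
    have in [C1_increment]. *)
Lemma MVT_line (f : V -> R) (y v : V) (t : R) :
  (forall s, `|s| <= `|t| -> derivable f (y + s *: v) v) ->
  exists2 s, `|s| <= `|t| & f (y + t *: v) - f y = t * 'D_v f (y + s *: v).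
Proof.
move=> df.
pose g u := f (y + u *: v).
have dg (s : R) : `|s| <= `|t| -> is_derive s 1 g ('D_v f (y + s *: v)).
  by move=> /df; exact: is_derive_line.
have cg (a b : R) : (forall s, s \in `[a, b] -> `|s| <= `|t|) ->
    {within `[a, b], continuous g}.
  move=> ab; apply: derivable_within_continuous => s /ab /dg [].
  by [].
have [t0|t0] := leP 0 t.
- have ab s : s \in `[0, t] -> `|s| <= `|t|.
    by rewrite in_itv/= => /andP[s0 st]; rewrite !ger0_norm.
  have dg' (s : R) : s \in `]0, t[ -> is_derive s 1 g ('D_v f (y + s *: v)).
    by move=> /subset_itv_oo_cc /ab /dg.
  have [s /ab st e] := MVT_segment t0 dg' (cg _ _ ab).
  by exists s => //; move: e; rewrite /g scale0r addr0 subr0 mulrC.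
- have ab s : s \in `[t, 0] -> `|s| <= `|t|.
    rewrite in_itv/= => /andP[st s0]; rewrite !ler0_norm ?lerN2//.
    exact: ltW.
  have dg' (s : R) : s \in `]t, 0[ -> is_derive s 1 g ('D_v f (y + s *: v)).
    by move=> /subset_itv_oo_cc /ab /dg.
  have [s /ab st e] := MVT_segment (ltW t0) dg' (cg _ _ ab).
  exists s => //; move: e; rewrite /g scale0r addr0 sub0r => e.
  by rewrite -opprB e mulrN opprK mulrC.
Qed.

End MeanValue.

Lemma ler_dist_halves (R : realFieldType) (u v w eps : R) :
  `|u - w| <= eps / 2 -> `|v - w| <= eps / 2 -> `|u - v| <= eps.
Proof.
move=> uw vw; apply: le_trans (ler_distD w _ _) _.
by rewrite [leRHS]splitr lerD// distrC.
Qed.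

Section Euclid.
Variables (R : realType) (n : nat).
Local Notation E := 'rV[R]_n.
Local Notation e_ k := (delta_mx 0 k : E).
Implicit Types (f g : E -> R) (V : set E).

Lemma coord_le_norm (h : E) k : `|h 0 k| <= `|h|.
Proof.
rewrite [leRHS]mx_normrE.
exact: (le_bigmax _ (fun ij => `|h ij.1 ij.2|) (0, k)).
Qed.

Lemma norm_le_of_coords (h : E) (r : R) :
  0 <= r -> (forall k, `|h 0 k| <= r) -> `|h| <= r.
Proof.
move=> r0 hr; rewrite [leLHS]mx_normrE; apply/bigmax_leP.
split => // -[i k] _ /=.
by rewrite ord1.
Qed.

(** The differential, at a point where the partial derivatives are [p]; it is
    kept as a linear form so that [diff_unique] applies. *)
Definition lincomb (p : 'I_n -> R) (h : E) : R := \sum_k h 0 k * p k.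

Lemma lincomb_is_linear p : linear (lincomb p).
Proof.
move=> a u v; rewrite /lincomb scaler_sumr -big_split; apply: eq_bigr => k _ /=.
by rewrite !mxE mulrDl -mulrA.
Qed.

HB.instance Definition _ p := GRing.isLinear.Build R E R _ (lincomb p)
  (lincomb_is_linear p).

Lemma lincomb_continuous p : continuous (lincomb p).
Proof.
move=> h; apply: differentiable_continuous.
rewrite (_ : lincomb p = \sum_(k < n) (fun h : E => h 0 k * p k)); last first.
  by apply/funext => u; rewrite fct_sumE.
apply: differentiable_sum => k; apply: differentiableM => //.
exact: differentiable_coord.
Qed.

(** The vertices of the path from [0] to [h] that moves along one coordinate
    axis at a time. *)
Definition trunc m (h : E) : E := \row_k (if (k < m)%N then h 0 k else 0).

Lemma trunc0 h : trunc 0 h = 0.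
Proof. by apply/rowP => k; rewrite !mxE. Qed.

Lemma truncn h : trunc n h = h.
Proof. by apply/rowP => k; rewrite !mxE ltn_ord. Qed.

Lemma truncS h (k : 'I_n) : trunc k.+1 h = trunc k h + h 0 k *: e_ k.
Proof.
apply/rowP => j; rewrite !mxE eqxx ltnS leq_eqVlt /=.
have [<-|kj] := eqVneq k j; first by rewrite eqxx ltnn mulr1 add0r.
by rewrite -[j == k :> nat]/(j == k) [j == k]eq_sym (negbTE kj) /= mulr0 addr0.
Qed.

Lemma norm_trunc_step (h : E) (k : 'I_n) (s : R) : `|s| <= `|h 0 k| ->
  `|trunc k h + s *: e_ k| <= `|h|.
Proof.
move=> sh; apply: norm_le_of_coords => // j; rewrite !mxE eqxx /=.
have [->|jk] := eqVneq j k.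
  by rewrite ltnn mulr1 add0r (le_trans sh)// coord_le_norm.
rewrite mulr0 addr0; case: ifP => _; first exact: coord_le_norm.
by rewrite normr0.
Qed.

(** Along the path of the [trunc m h] each step changes one coordinate only, so
    the mean value theorem turns it into a partial derivative; in the sup norm
    the whole path stays in the ball of radius [`|h|]. *)
Lemma C1_increment f (y h : E) (p : 'I_n -> R) (eps : R) :
  (forall k z, `|z| <= `|h| -> derivable f (y + z) (e_ k)) ->
  (forall k z, `|z| <= `|h| -> `|pderiv k f (y + z) - p k| <= eps) ->
  `|f (y + h) - f y - lincomb p h| <= eps * `|h| *+ n.
Proof.
move=> df dp.
have H m : (m <= n)%N ->
    `|f (y + trunc m h) - f y - \sum_(k < n | (k < m)%N) h 0 k * p k|
      <= eps * `|h| *+ m.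
  elim: m => [_|m IH mn].
    by rewrite trunc0 addr0 subrr big_pred0// subrr normr0 mulr0n.
  pose k := Ordinal mn.
  rewrite (bigD1 k) //= (eq_bigl (fun j : 'I_n => (j < m)%N)); last first.
    move=> j; rewrite ltnS ltn_neqAle andbC; congr (_ && _).
  have [s sh e] : exists2 s, `|s| <= `|h 0 k| &
      f (y + trunc m h + h 0 k *: e_ k) - f (y + trunc m h)
      = h 0 k * 'D_(e_ k) f (y + trunc m h + s *: e_ k).
    apply: MVT_line => s sh; rewrite -addrA; apply: df.
    exact: (@norm_trunc_step h k).
  rewrite (truncS h k) addrA mulrSr.
  set S := \sum_(_ < n | _) _.
  rewrite (_ : _ - _ - _ = (f (y + trunc m h) - f y - S)
    + h 0 k * (pderiv k f (y + (trunc m h + s *: e_ k)) - p k)); last first.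
    move: e; rewrite /pderiv addrA.
    set u := f (_ + _ + _); set w := f (_ + _).
    move=> /eqP; rewrite subr_eq => /eqP ->; ring.
  apply: (le_trans (ler_normD _ _)); apply: lerD; first exact/IH/ltnW.
  rewrite normrM mulrC; apply: ler_pM => //; last exact: coord_le_norm.
  by apply: dp; exact: (@norm_trunc_step h k).
have := H n (leqnn n); rewrite truncn /lincomb.
by under eq_bigl do rewrite ltn_ord.
Qed.

(** [C1_increment], with [p] the partial derivatives at [y], bounds the
    remainder of the first-order expansion by any multiple of [`|h|]. *)
Lemma C1_differentiable f (y : E) :
  (forall k, \forall z \near y, derivable f z (e_ k)) ->
  (forall k, {for y, continuous (pderiv k f)}) -> differentiable f y.
Proof.
move=> df cf.
pose p k := pderiv k f y.
suff H : (f \o shift y : E -> R^o) =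
    cst (f y) + (lincomb p : E -> R^o) +o_ (0 : E) (id : E -> E).
  have Hd := diff_unique (@lincomb_continuous p) H.
  apply/diff_locallyP; rewrite Hd; split => //; exact: lincomb_continuous.
apply/eqaddoP => eps eps0.
have n0 : 0 < n.+1%:R :> R by rewrite ltr0Sn.
(* [n.+1] and not [n], since the dimension may be 0 *)
pose e' := eps / n.+1%:R.
have e'0 : 0 < e' by rewrite divr_gt0.
have : \forall z \near y, forall k, derivable f z (e_ k) /\
    `|pderiv k f z - p k| <= e'.
  apply: (filter_forall (nbhs_filter y)) => k.
  apply: filterI; first exact: df.
  have := cf k => /cvgrPdist_le /(_ _ e'0).
  by apply: filterS => z; rewrite distrC.
move=> /nbhs_normP[d /= d0 yd].
rewrite !near_simpl.
apply/(@nbhs_norm0P _ E); exists d => //= h /= hd.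
have bd z : `|z| <= `|h| -> forall k, derivable f (y + z) (e_ k) /\
    `|pderiv k f (y + z) - p k| <= e'.
  move=> zh; apply: yd; rewrite /= opprD addrA subrr sub0r normrN.
  exact: le_lt_trans zh hd.
have := @C1_increment f y h p e' (fun k z zh => (bd z zh k).1)
  (fun k z zh => (bd z zh k).2).
rewrite -[X in _ -> `|X| <= _]/(f (h + y) - (f y + lincomb p h)) [h + y]addrC.
rewrite opprD addrA => /le_trans; apply.
rewrite -mulr_natr mulrAC ler_wpM2r// /e' -mulrA ler_piMr//; first exact: ltW.
by rewrite mulrC ler_pdivrMr// mul1r ler_nat.
Qed.

(** The mean value theorem is applied to [g z = f (z + t e_b) - f z] along
    [e_a], then to the partial derivative of [f] along [e_b]. The left-hand
    side is symmetric in [a] and [b], which is what [schwarz] exploits. *)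
Lemma second_difference f (y : E) (a b : 'I_n) (t : R) :
  (forall z, `|z - y| <= `|t| *+ 2 ->
     derivable f z (e_ a) /\ derivable (pderiv a f) z (e_ b)) ->
  exists2 z, `|z - y| <= `|t| *+ 2 &
    f (y + t *: e_ a + t *: e_ b) - f (y + t *: e_ a) - f (y + t *: e_ b) + f y
    = t ^+ 2 * pderiv b (pderiv a f) z.
Proof.
move=> df.
have ne k (s : R) : `|s| <= `|t| -> `|s *: e_ k| <= `|t|.
  move=> st; apply: norm_le_of_coords => // j; rewrite !mxE eqxx /=.
  by case: (j == k); rewrite ?mulr1// mulr0 normr0.
have nb s s' : `|s| <= `|t| -> `|s'| <= `|t| ->
    `|y + s *: e_ a + s' *: e_ b - y| <= `|t| *+ 2.
  move=> st st'; rewrite addrAC [X in X + _]addrAC subrr add0r mulr2n.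
  by apply: le_trans (ler_normD _ _) _; apply: lerD; exact: ne.
have n0 : `|0 : R| <= `|t| by rewrite normr0.
pose g z := f (z + t *: e_ b) - f z.
have dg s : `|s| <= `|t| -> is_derive (y + s *: e_ a) (e_ a) g
    (pderiv a f (y + s *: e_ a + t *: e_ b) - pderiv a f (y + s *: e_ a)).
  move=> st; apply: is_deriveB; last first.
    apply: derivableP; have := (df _ (nb s 0 st n0)).1.
    by rewrite scale0r addr0.
  have := (df _ (nb s t st (lexx _))).1.
  set w := y + s *: e_ a => dw.
  have E' : (fun h : R => h^-1 *: (((fun z => f (z + t *: e_ b)) \o shift w)
            (h *: e_ a) - f (w + t *: e_ b)))
       = (fun h => h^-1 *: ((f \o shift (w + t *: e_ b)) (h *: e_ a)
            - f (w + t *: e_ b))).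
    apply/funext => h /=.
    by have -> : h *: e_ a + (w + t *: e_ b) = h *: e_ a + w + t *: e_ b
      by rewrite addrA.
  by split; rewrite /derivable /pderiv /derive E'.
have [s st e] := @MVT_line _ _ g y (e_ a) t
  (fun s st => @ex_derive _ _ _ _ _ _ _ (dg s st)).
have [s' st' e'] : exists2 s', `|s'| <= `|t| &
    pderiv a f (y + s *: e_ a + t *: e_ b) - pderiv a f (y + s *: e_ a)
    = t * pderiv b (pderiv a f) (y + s *: e_ a + s' *: e_ b).
  apply: MVT_line => s' st'; exact: (df _ (nb s s' st st')).2.
exists (y + s *: e_ a + s' *: e_ b); first exact: nb.
move: e; rewrite (@derive_val _ _ _ _ _ _ _ (dg s st)) e' /g => e.
rewrite expr2 -mulrA -e.
by move: (f _) (f _) (f _) (f _) => u1 u2 u3 u4; ring.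
Qed.

(** By [second_difference] used in both orders, the two mixed derivatives agree
    at two points that are arbitrarily close to [y]; they are continuous. *)
Lemma schwarz f V (a b : 'I_n) y : open V -> V y -> is_C 2 V f ->
  pderiv b (pderiv a f) y = pderiv a (pderiv b f) y.
Proof.
move=> oV Vy [_ C].
have D k l z : V z -> derivable f z (e_ k) /\ derivable (pderiv k f) z (e_ l).
  by move=> Vz; have [d [_ /(_ l)[dd _]]] := C k; split; [exact: d|exact: dd].
have K k l : {for y, continuous (pderiv l (pderiv k f))}.
  by have [_ [_ /(_ l)[_ /=[c _]]]] := C k; exact: c.
apply/eqP; rewrite -subr_eq0 -normr_le0; apply/ler_addgt0Pl => eps eps0.
rewrite addr0.
have e2 : 0 < eps / 2 by rewrite divr_gt0.
have : \forall z \near y, V z /\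
   (`|pderiv b (pderiv a f) y - pderiv b (pderiv a f) z| <= eps / 2 /\
    `|pderiv a (pderiv b f) y - pderiv a (pderiv b f) z| <= eps / 2).
  apply: filterI; first exact: open_nbhs_nbhs.
  by apply: filterI; [move: (K a b)|move: (K b a)] =>
    /cvgrPdist_le /(_ _ e2).
move=> /nbhs_normP[d /= d0 yd].
(* the points provided by [second_difference] are within [2 * t < d] of [y] *)
pose t := d / 4.
have t0 : 0 < t by rewrite divr_gt0.
have td z : `|z - y| <= `|t| *+ 2 -> `|y - z| < d.
  rewrite distrC => /le_lt_trans; apply.
  by rewrite gtr0_norm// /t -mulr_natr; lra.
have [z zt e] := @second_difference f y a b t
  (fun z zt => D a b z (yd z (td z zt)).1).
have [z' zt' e'] := @second_difference f y b a t
  (fun z zt => D b a z (yd z (td z zt)).1).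
have E' : pderiv b (pderiv a f) z = pderiv a (pderiv b f) z'.
  apply: (@mulfI _ (t ^+ 2)); first by rewrite expf_neq0// gt_eqF.
  apply: etrans (esym e) _; apply: etrans _ e'.
  rewrite [y + t *: e_ b + _]addrAC; congr (_ + _).
  exact: addrAC.
have [_ [h _]] := yd z (td z zt).
have [_ [_ h']] := yd z' (td z' zt').
by rewrite E' in h; exact: ler_dist_halves h h'.
Qed.

End Euclid.

(** * The algebra of C^1 functions *)

Section C1.
Variables (R : realType) (n : nat).
Local Notation E := 'rV[R]_n.
Local Notation e_ k := (delta_mx 0 k : E).
Implicit Types (f g : E -> R) (V : set E).

Lemma is_C_subset r V V' f : V' `<=` V -> is_C r V f -> is_C r V' f.
Proof.
move=> VV'; elim: r f => [|r IH] f /= [cf Cf].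
  by split=> // y /VV'; exact: cf.
split=> [y /VV'|k]; first exact: cf.
by have [df Ck] := Cf k; split=> [y /VV'|]; [exact: df|exact: IH].
Qed.

Lemma is_C_lower r V f : is_C r.+1 V f -> is_C r V f.
Proof.
elim: r f => [|r IH] f; first by move=> [].
by move=> [cf Cf]; split=> // k; have [df Ck] := Cf k; split=> //; exact: IH.
Qed.

Lemma eq_open_near V f g y : open V -> V y -> (forall z, V z -> f z = g z) ->
  \forall z \near y, f z = g z.
Proof. by move=> oV Vy fg; apply: filterS fg _; exact: open_nbhs_nbhs. Qed.

Lemma eq_open_pderiv V f g k y : open V -> V y ->
  (forall z, V z -> f z = g z) -> pderiv k f y = pderiv k g y.
Proof.
by move=> oV Vy fg; apply: near_eq_derive; exact: eq_open_near fg.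
Qed.

Lemma eq_open_continuous V f g y : open V -> V y ->
  (forall z, V z -> f z = g z) ->
  {for y, continuous f} -> {for y, continuous g}.
Proof.
move=> oV Vy fg cf; rewrite /prop_for /continuous_at -fg//.
apply: cvg_trans cf; apply: (@near_eq_cvg _ _ (nbhs y) (nbhs_filter y)).
exact: eq_open_near oV Vy fg.
Qed.

(** Transition maps and components are known only on open sets, and their
    composites with the inverse charts have junk values elsewhere; this lemma
    is what makes those values irrelevant. *)
Lemma is_C_ext r V f g : open V -> (forall y, V y -> f y = g y) ->
  is_C r V f -> is_C r V g.
Proof.
move=> oV; elim: r f g => [|r IH] f g fg [cf Cf].
- by split=> // y Vy; apply: eq_open_continuous fg (cf _ Vy).
- split=> [y Vy|k].
    by apply: eq_open_continuous fg (cf _ Vy).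
  have [df Ck] := Cf k; split=> [y Vy|].
    by apply: near_eq_derivable (df y Vy); exact: eq_open_near fg.
  by apply: IH Ck => y Vy; exact: eq_open_pderiv fg.
Qed.

(** Differentiability, unlike the mere existence of partial derivatives, is
    stable under composition; all closure properties go through this form. *)
Lemma is_C1P V f : open V -> is_C 1 V f <->
  (forall y, V y -> differentiable f y /\
    forall k, {for y, continuous (pderiv k f)}).
Proof.
move=> oV; split=> [[_ Cf] y Vy|H].
  have cp k : {for y, continuous (pderiv k f)}.
    by have [_ [c _]] := Cf k; exact: c.
  split=> //; apply: C1_differentiable => // k.
  have [d _] := Cf k; apply: filterS d _; exact: open_nbhs_nbhs.
split=> [y /H[/differentiable_continuous]//|k].
by split=> [y /H[d _]|]; [exact: diff_derivable|split=> // y /H[_]].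
Qed.

Lemma C1_diff V f y : open V -> is_C 1 V f -> V y -> differentiable f y.
Proof. by move=> oV /(is_C1P _ oV) H /H[]. Qed.

Lemma C1_cont V f k y : open V -> is_C 1 V f -> V y ->
  {for y, continuous (pderiv k f)}.
Proof. by move=> oV /(is_C1P _ oV) H /H[_]. Qed.

Lemma pderiv_cst k (c : R) (y : E) : pderiv k (fun=> c) y = 0.
Proof. exact: derive_cst. Qed.

Lemma pderivD k f g y : differentiable f y -> differentiable g y ->
  pderiv k (fun z => f z + g z) y = pderiv k f y + pderiv k g y.
Proof. by move=> df dg; apply: deriveD; exact: diff_derivable. Qed.

Lemma pderivM k f g y : differentiable f y -> differentiable g y ->
  pderiv k (fun z => f z * g z) y = pderiv k f y * g y + f y * pderiv k g y.
Proof.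
move=> df dg.
rewrite /pderiv [LHS]deriveM; [|exact: diff_derivable..].
by rewrite addrC /GRing.scale/= mulrC.
Qed.

Lemma differentiable_big_sum (I : Type) (s : seq I) (P : pred I)
    (F : I -> E -> R) y :
  (forall i, P i -> differentiable (F i) y) ->
  differentiable (fun z => \sum_(i <- s | P i) F i z) y.
Proof.
move=> dF; elim: s => [|i s IH].
  rewrite (_ : (fun _ => _) = cst 0) //.
  by apply/funext => z; rewrite big_nil.
case: (boolP (P i)) => [Pi|nPi].
  rewrite (_ : (fun _ => _) = F i + (fun z => \sum_(i <- s | P i) F i z)).
    by apply: differentiableD => //; exact: dF.
  by apply/funext => z; rewrite big_cons Pi.
rewrite (_ : (fun _ => _) = (fun z => \sum_(i <- s | P i) F i z)) //.
by apply/funext => z; rewrite big_cons (negbTE nPi).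
Qed.

Lemma pderiv_sum (I : Type) (s : seq I) (P : pred I) (F : I -> E -> R) k y :
  (forall i, P i -> differentiable (F i) y) ->
  pderiv k (fun z => \sum_(i <- s | P i) F i z) y =
  \sum_(i <- s | P i) pderiv k (F i) y.
Proof.
move=> dF; elim: s => [|i s IH].
  rewrite big_nil -[RHS](pderiv_cst k 0 y); congr (pderiv _ _ _).
  by apply/funext => z; rewrite big_nil.
rewrite big_cons -IH.
case: (boolP (P i)) => [Pi|nPi].
  rewrite -pderivD; [|exact: dF|exact: differentiable_big_sum].
  by congr (pderiv _ _ _); apply/funext => z; rewrite big_cons Pi.
by congr (pderiv _ _ _); apply/funext => z; rewrite big_cons (negbTE nPi).
Qed.

Lemma pderiv_coord (k l : 'I_n) (y : E) :
  pderiv l (fun z : E => z 0 k) y = (k == l)%:R.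
Proof.
have L : linear (fun z : E => z 0 k : R) by move=> a u v; rewrite !mxE.
pose H := GRing.isLinear.Build R E R _ (fun z : E => z 0 k : R) L.
pose c : {linear E -> R} := HB.pack (fun z : E => z 0 k : R) H.
rewrite /pderiv deriveE; last exact: differentiable_coord.
have := @diff_lin R _ _ c y (@coord_continuous R 1 n 0 k) => /= ->.
by rewrite mxE eqxx.
Qed.

Section Closure.
Variables (V : set E) (oV : open V).

Lemma is_C1_cst (c : R) : is_C 1 V (fun=> c).
Proof.
apply/is_C1P => // y Vy; split=> // k.
rewrite (_ : pderiv _ _ = cst 0); first exact: cst_continuous.
by apply/funext => z; rewrite pderiv_cst.
Qed.

Lemma is_C1_D f g : is_C 1 V f -> is_C 1 V g -> is_C 1 V (fun z => f z + g z).
Proof.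
move=> Cf Cg; apply/is_C1P => // y Vy; split.
  by apply: differentiableD; [exact: C1_diff oV Cf Vy|exact: C1_diff oV Cg Vy].
move=> k; apply: eq_open_continuous oV Vy _
  (continuousD (C1_cont (k := k) oV Cf Vy) (C1_cont (k := k) oV Cg Vy)).
by move=> z Vz; rewrite pderivD //;
  [exact: C1_diff oV Cf Vz|exact: C1_diff oV Cg Vz].
Qed.

Lemma is_C1_M f g : is_C 1 V f -> is_C 1 V g -> is_C 1 V (fun z => f z * g z).
Proof.
move=> Cf Cg; apply/is_C1P => // y Vy.
have df z : V z -> differentiable f z by move=> Vz; exact: C1_diff oV Cf Vz.
have dg z : V z -> differentiable g z by move=> Vz; exact: C1_diff oV Cg Vz.
split; first by apply: differentiableM; [exact: df|exact: dg].
move=> k; have cM := continuousD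
  (continuousM (C1_cont (k := k) oV Cf Vy)
               (differentiable_continuous (dg y Vy)))
  (continuousM (differentiable_continuous (df y Vy))
               (C1_cont (k := k) oV Cg Vy)).
apply: eq_open_continuous oV Vy _ cM => z Vz.
by rewrite pderivM //; [exact: df|exact: dg].
Qed.

Lemma is_C1_sum (I : Type) (s : seq I) (P : pred I) (F : I -> E -> R) :
  (forall i, P i -> is_C 1 V (F i)) ->
  is_C 1 V (fun z => \sum_(i <- s | P i) F i z).
Proof.
move=> CF; elim: s => [|i s IH].
  by apply: is_C_ext (is_C1_cst 0) => // z _; rewrite big_nil.
case: (boolP (P i)) => [Pi|nPi].
  by apply: is_C_ext (is_C1_D (CF i Pi) IH) => // z _; rewrite big_cons Pi.
by apply: is_C_ext IH => // z _; rewrite big_cons (negbTE nPi).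
Qed.

Lemma is_C1_prod (I : Type) (s : seq I) (P : pred I) (F : I -> E -> R) :
  (forall i, P i -> is_C 1 V (F i)) ->
  is_C 1 V (fun z => \prod_(i <- s | P i) F i z).
Proof.
move=> CF; elim: s => [|i s IH].
  by apply: is_C_ext (is_C1_cst 1) => // z _; rewrite big_nil.
case: (boolP (P i)) => [Pi|nPi].
  by apply: is_C_ext (is_C1_M (CF i Pi) IH) => // z _; rewrite big_cons Pi.
by apply: is_C_ext IH => // z _; rewrite big_cons (negbTE nPi).
Qed.

Lemma is_C1_coord k : is_C 1 V (fun z => z 0 k).
Proof.
apply/is_C1P => // y Vy; split; first exact: differentiable_coord.
move=> l; rewrite (_ : pderiv _ _ = cst ((k == l)%:R)).
  exact: cst_continuous.
by apply/funext => z; rewrite pderiv_coord.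
Qed.

Lemma is_C1_V f : (forall y, V y -> f y != 0) -> is_C 1 V f ->
  is_C 1 V (fun z => (f z)^-1).
Proof.
move=> f0 Cf.
have df z : V z -> differentiable f z by move=> Vz; exact: C1_diff oV Cf Vz.
apply/is_C1P => // y Vy; split.
  exact: differentiableV (df y Vy) (f0 y Vy).
have pV k z : V z ->
    pderiv k (fun z => (f z)^-1) z = - (f z) ^- 2 * pderiv k f z.
  move=> Vz; rewrite /pderiv [LHS]deriveV //; first exact: f0.
  exact/diff_derivable/df.
move=> k; have c1 := differentiable_continuous (df y Vy).
have f2 : f y ^+ 2 != 0 by rewrite expf_neq0// f0.
have c2 : {for y, continuous (fun z => f z ^+ 2)} by exact: (continuousM c1 c1).
have c3 : {for y, continuous (fun z => - (f z) ^- 2)}.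
  exact: (continuousN (@continuousV _ _ (fun z => f z ^+ 2) y f2 c2)).
apply: eq_open_continuous oV Vy _
  (continuousM c3 (C1_cont (k := k) oV Cf Vy)) => z Vz.
by rewrite pV.
Qed.

Lemma is_C1_det m (G : E -> 'M[R]_m) :
  (forall i j, is_C 1 V (fun z => G z i j)) -> is_C 1 V (fun z => \det (G z)).
Proof.
move=> CG; rewrite /determinant; apply: is_C1_sum => s _.
by apply: is_C1_M; [exact: is_C1_cst|apply: is_C1_prod => i _].
Qed.

(** By Cramer's rule the entries of the inverse are rational in those of
    [G]. *)
Lemma is_C1_invmx m (G : E -> 'M[R]_m) :
  (forall z, V z -> G z \in unitmx) ->
  (forall i j, is_C 1 V (fun z => G z i j)) ->
  forall i j, is_C 1 V (fun z => invmx (G z) i j).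
Proof.
move=> uG CG i j.
have E1 z : V z -> (\det (G z))^-1 * cofactor (G z) j i = invmx (G z) i j.
  by move=> Vz; rewrite /invmx uG// !mxE.
apply: (is_C_ext oV E1).
apply: is_C1_M.
  apply: is_C1_V; last exact: is_C1_det.
  by move=> z /uG; rewrite unitmxE unitfE.
rewrite /cofactor; apply: is_C1_M; first exact: is_C1_cst.
apply: is_C1_det => a b; apply: is_C_ext (CG (lift j a) (lift i b)) => // z _.
by rewrite !mxE.
Qed.

End Closure.

Definition pderiv_mx m p k (G : E -> 'M[R]_(m, p)) (y : E) : 'M[R]_(m, p) :=
  \matrix_(i, j) pderiv k (fun z => G z i j) y.

(** Differentiate [invmx (G z) *m G z = 1] entry by entry. *)
Lemma pderiv_invmx V m k (G : E -> 'M[R]_m) y : open V -> V y ->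
  (forall z, V z -> G z \in unitmx) ->
  (forall i j, is_C 1 V (fun z => G z i j)) ->
  pderiv_mx k (fun z => invmx (G z)) y
  = - (invmx (G y) *m pderiv_mx k G y *m invmx (G y)).
Proof.
move=> oV Vy uG CG; have CI := is_C1_invmx oV uG CG.
have H : pderiv_mx k (fun z => invmx (G z)) y *m G y
    + invmx (G y) *m pderiv_mx k G y = 0.
  apply/matrixP => i j; rewrite !mxE -big_split /=.
  transitivity (pderiv k (fun z => \sum_l invmx (G z) i l * G z l j) y).
    rewrite pderiv_sum; last first.
      by move=> l _; apply: differentiableM;
        [exact: C1_diff oV (CI _ _) Vy|exact: C1_diff oV (CG _ _) Vy].
    apply: eq_bigr => l _; rewrite pderivM; [|exact: C1_diff oV (CI _ _) Vy|
      exact: C1_diff oV (CG _ _) Vy].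
    by rewrite !mxE.
  rewrite -[RHS](pderiv_cst k ((1%:M : 'M[R]_m) i j) y).
  apply: eq_open_pderiv oV Vy _ => z Vz.
  transitivity ((invmx (G z) *m G z) i j); first by rewrite [RHS]mxE.
  by rewrite mulVmx ?uG.
rewrite -mulNmx -[LHS](mulmxK (uG y Vy)); congr (_ *m _).
by apply/eqP; rewrite -addr_eq0 H.
Qed.

End C1.

(** * Composition *)

Section Composition.
Variables (R : realType) (n m : nat).
Implicit Types (phi : 'rV[R]_n -> 'rV[R]_m) (g : 'rV[R]_m -> R).

Lemma differentiable_rV phi y :
  (forall a, differentiable (fun z => phi z 0 a) y) -> differentiable phi y.
Proof.
move=> dphi.
rewrite (_ : phi =
    \sum_(a < m) (fun z => phi z 0 a *: (delta_mx 0 a : 'rV[R]_m))).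
  by apply: differentiable_sum => a; exact: differentiableZl.
by apply/funext => z; rewrite fct_sumE -row_sum_delta.
Qed.

Lemma pderiv_comp phi g k y :
  (forall a, differentiable (fun z => phi z 0 a) y) ->
  differentiable g (phi y) ->
  pderiv k (g \o phi) y =
  \sum_a pderiv a g (phi y) * pderiv k (fun z => phi z 0 a) y.
Proof.
move=> dphi dg; have dp := differentiable_rV dphi.
rewrite /pderiv deriveE; last exact: differentiable_comp.
rewrite diff_comp//=.
have -> : 'd phi y (delta_mx 0 k) =
    \sum_a pderiv k (fun z => phi z 0 a) y *: (delta_mx 0 a : 'rV[R]_m).
  rewrite -deriveE// derive_mx; last exact: diff_derivable.
  by rewrite [LHS]row_sum_delta; apply: eq_bigr => a _; rewrite mxE.
rewrite linear_sum; apply: eq_bigr => a _.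
by rewrite linearZ /= -deriveE// mulrC.
Qed.

Lemma is_C1_comp (V : set 'rV[R]_n) (V' : set 'rV[R]_m) phi g :
  open V -> open V' -> (forall y, V y -> V' (phi y)) ->
  (forall a, is_C 1 V (fun z => phi z 0 a)) -> is_C 1 V' g ->
  is_C 1 V (g \o phi).
Proof.
move=> oV oV' VV' Cp Cg.
have dp z : V z -> forall a, differentiable (fun z => phi z 0 a) z.
  by move=> Vz a; exact: C1_diff oV (Cp a) Vz.
have dg z : V z -> differentiable g (phi z).
  by move=> Vz; exact: C1_diff oV' Cg (VV' _ Vz).
apply/is_C1P => // y Vy; split.
  by apply: differentiable_comp;
    [apply: differentiable_rV; exact: dp|exact: dg].
move=> k; have cphi := differentiable_continuous (differentiable_rV (dp y Vy)).
suff c : {for y, continuous (fun z =>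
    \sum_a pderiv a g (phi z) * pderiv k (fun z => phi z 0 a) z)}.
  apply: eq_open_continuous oV Vy _ c => z Vz.
  by rewrite pderiv_comp; [|exact: dp|exact: dg].
apply: (@cvg_big _ _ _ _ _ (@add_continuous R) _ (nbhs y) _ _ _
  (nbhs_filter y)) => a _.
apply: (@continuousM R _ (fun z => pderiv a g (phi z))).
  by apply: continuous_comp cphi _; exact: C1_cont oV' Cg (VV' _ Vy).
exact: C1_cont oV (Cp a) Vy.
Qed.

End Composition.

(** * Functions and Jacobians in the charts of a manifold *)

Section Charts.
Variables (R : realType) (n : nat) (M : manifold R n).
Local Notation chart := (mf_chart M).
Implicit Types (c : chart) (U : set M) (x : M) (f : M -> R).

Definition chart_image c U : set 'rV[R]_n := mf_coord M c @` (U `&` mf_dom M c).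

Lemma chart_imageP c U y : chart_image c U y ->
  [/\ U (mf_inv M c y), mf_dom M c (mf_inv M c y)
    & mf_coord M c (mf_inv M c y) = y].
Proof. by move=> [x [Ux cx] <-]; rewrite mf_coordK. Qed.

Lemma mem_chart_image c U x :
  U x -> mf_dom M c x -> chart_image c U (mf_coord M c x).
Proof. by move=> Ux cx; exists x. Qed.

Lemma open_chart_image c U : open U -> open (chart_image c U).
Proof.
move=> oU; rewrite openE => y Uy; have [Ux cx yE] := chart_imageP Uy.
have oD := @mf_img_open _ _ M c.
have Dy : (mf_coord M c @` mf_dom M c) y by exists (mf_inv M c y).
have nD : nbhs y (mf_coord M c @` mf_dom M c) by exact: open_nbhs_nbhs.
have nU : \forall z \near y, U (mf_inv M c z).
  by apply: (mf_inv_continuous Dy); exact: open_nbhs_nbhs.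
apply: filterS2 nD nU => z [w cw <-]; rewrite mf_coordK// => Uw.
by exists w.
Qed.

Definition C1_in c U f := is_C 1 (chart_image c U) (f \o mf_inv M c).

Lemma coord_C2 c c' k :
  is_C 2 (chart_image c (mf_dom M c'))
    (fun y => mf_coord M c' (mf_inv M c y) 0 k).
Proof. by rewrite /chart_image setIC; exact: mf_transition. Qed.

Lemma coord_C1 c c' k : C1_in c (mf_dom M c') (fun z => mf_coord M c' z 0 k).
Proof. exact: is_C_lower (coord_C2 c c' k). Qed.

Lemma C1_in_subset c U U' f : U' `<=` U -> C1_in c U f -> C1_in c U' f.
Proof.
by move=> UU'; apply: is_C_subset => y [x [/UU' Ux cx] <-]; exists x.
Qed.

Lemma cderiv_ext c U f g k x : open U -> U x -> mf_dom M c x ->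
  (forall x, U x -> mf_dom M c x -> f x = g x) ->
  cderiv c k f x = cderiv c k g x.
Proof.
move=> oU Ux cx fg.
apply: (eq_open_pderiv _ (open_chart_image oU) (mem_chart_image Ux cx)).
by move=> y /chart_imageP[Uy cy _]; exact: fg.
Qed.

Lemma C1_in_diff c U f x : open U -> C1_in c U f -> U x -> mf_dom M c x ->
  differentiable (f \o mf_inv M c) (mf_coord M c x).
Proof.
move=> oU Cf Ux cx.
exact: C1_diff (open_chart_image oU) Cf (mem_chart_image Ux cx).
Qed.

Lemma C1_in_change c c' U f : open U -> C1_in c' U f ->
  C1_in c (U `&` mf_dom M c') f.
Proof.
move=> oU Cf; have oc' := mf_dom_open (m := M) c'.
have oUc : open (U `&` mf_dom M c') by exact: openI.
pose phi y := mf_coord M c' (mf_inv M c y).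
apply: (@is_C_ext _ _ _ _ ((f \o mf_inv M c') \o phi)).
  exact: open_chart_image.
  by move=> y /chart_imageP[[Uy c'y] cy _] /=; rewrite /phi mf_coordK.
apply: (is_C1_comp (open_chart_image oUc) (open_chart_image oU)) Cf.
  by move=> y /chart_imageP[[Uy c'y] cy _]; exact: mem_chart_image.
move=> k; have := coord_C1 c c' k; apply: C1_in_subset; exact: subIsetr.
Qed.

(** Near [x] the expression of [f] in [c] is its expression in [c'] composed
    with the change of coordinates. *)
Lemma cderiv_change c c' U f l x : open U -> U x -> mf_dom M c x ->
  mf_dom M c' x -> C1_in c' U f ->
  cderiv c l f x = \sum_k cderiv c' k f x * jac c c' x k l.
Proof.
move=> oU Ux cx c'x Cf; have oc' := mf_dom_open (m := M) c'.
have oUc : open (U `&` mf_dom M c') by exact: openI.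
pose phi y := mf_coord M c' (mf_inv M c y).
transitivity (pderiv l ((f \o mf_inv M c') \o phi) (mf_coord M c x)).
  apply: (eq_open_pderiv _ (open_chart_image oUc)).
    exact: mem_chart_image.
  by move=> y /chart_imageP[[Uy c'y] cy _] /=; rewrite /phi mf_coordK.
have phiE : phi (mf_coord M c x) = mf_coord M c' x by rewrite /phi mf_coordK.
rewrite pderiv_comp; first by rewrite phiE.
  by move=> k; exact: (C1_in_diff oc' (coord_C1 c c' k)).
by rewrite phiE; exact: (C1_in_diff oU).
Qed.

(** This is [cderiv_change] for the coordinates of [c'']. *)
Lemma jac_cocycle c c' c'' x k l :
  mf_dom M c x -> mf_dom M c' x -> mf_dom M c'' x ->
  jac c c'' x k l = \sum_m jac c' c'' x k m * jac c c' x m l.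
Proof.
move=> cx c'x c''x.
exact (cderiv_change l (mf_dom_open (m := M) c'') c''x cx c'x
  (coord_C1 c' c'' k)).
Qed.

Lemma jac_id c x k l : mf_dom M c x -> jac c c x k l = (k == l)%:R.
Proof.
move=> cx; rewrite -(pderiv_coord k l (mf_coord M c x)).
apply: (eq_open_pderiv _ (open_chart_image (mf_dom_open (m := M) c))).
  exact: mem_chart_image.
by move=> y /chart_imageP[_ _ /= ->].
Qed.

(** Here the charts have to be C^2-compatible. *)
Lemma jac_C1 c c' k l : C1_in c (mf_dom M c') (fun z => jac c c' z k l).
Proof.
have CJ : is_C 1 (chart_image c (mf_dom M c'))
    (pderiv l (fun y => mf_coord M c' (mf_inv M c y) 0 k)).
  by have [_ /(_ l)[_ H]] := coord_C2 c c' k; exact H.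
apply: is_C_ext CJ; first exact/open_chart_image/mf_dom_open.
by move=> y /chart_imageP[_ _ yE]; rewrite /= /jac /cderiv yE.
Qed.

(** The second derivatives of the change of coordinates commute; the Lie
    bracket owes its tensorial character to this. *)
Lemma jac_sym c c' k l m x : mf_dom M c x -> mf_dom M c' x ->
  cderiv c m (fun z => jac c c' z k l) x =
  cderiv c l (fun z => jac c c' z k m) x.
Proof.
move=> cx c'x; have oI := open_chart_image (c := c) (mf_dom_open (m := M) c').
have Ix := mem_chart_image c'x cx.
have E a b : cderiv c b (fun z => jac c c' z k a) x = pderiv b (pderiv a
    (fun y => mf_coord M c' (mf_inv M c y) 0 k)) (mf_coord M c x).
  apply: (eq_open_pderiv _ oI Ix) => y /chart_imageP[_ _ yE].
  by rewrite /= /jac /cderiv yE.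
by rewrite !E; exact: schwarz oI Ix (coord_C2 c c' k).
Qed.

Definition jac_mx c c' x : 'M[R]_n := \matrix_(k, l) jac c c' x k l.

Lemma jac_mxV c c' x : mf_dom M c x -> mf_dom M c' x ->
  jac_mx c' c x *m jac_mx c c' x = 1%:M.
Proof.
move=> cx c'x; apply/matrixP => i j; rewrite !mxE -(jac_id i j cx).
by rewrite (jac_cocycle _ _ cx c'x cx); apply: eq_bigr => m _; rewrite !mxE.
Qed.

End Charts.

(** * Vector fields, brackets and derivations under a change of chart *)

Section MultiIndices.
Variables (R : realType) (n : nat).

Lemma ffun1E (a : {ffun 'I_1 -> 'I_n}) : a = [ffun=> a ord0].
Proof. by apply/ffunP => s; rewrite ffunE ord1. Qed.

Lemma ffun0E (a b : {ffun 'I_0 -> 'I_n}) : a = b.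
Proof. by apply/ffunP => -[]. Qed.

Lemma sum_ffun1 (F : {ffun 'I_1 -> 'I_n} -> R) :
  \sum_a F a = \sum_k F [ffun=> k].
Proof.
rewrite (reindex (fun k : 'I_n => [ffun=> k])) //=.
exists (fun a => a ord0) => [k _|a _]; first by rewrite ffunE.
by rewrite [RHS]ffun1E.
Qed.

Lemma sum_ffun0 (F : {ffun 'I_0 -> 'I_n} -> R) b : \sum_a F a = F b.
Proof.
rewrite (bigD1 b)//= big1 ?addr0// => a /negP[]; apply/eqP; exact: ffun0E.
Qed.

Lemma set_index1 (k l : 'I_n) s :
  set_index [ffun=> k] s l = [ffun=> l] :> {ffun 'I_1 -> 'I_n}.
Proof. by apply/ffunP => t; rewrite !ffunE !ord1 eqxx. Qed.

End MultiIndices.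

Section VectorFields.
Variables (R : realType) (n : nat) (M : manifold R n).
Local Notation chart := (mf_chart M).
Implicit Types (c : chart) (U : set M) (x : M) (f : M -> R).

Lemma vec_change U (Y : tensor_field 1 0 U) c c' k x :
  U x -> mf_dom M c x -> mf_dom M c' x ->
  vec_comp Y c' k x = \sum_l jac c c' x k l * vec_comp Y c l x.
Proof.
move=> Ux cx c'x; rewrite /vec_comp (tf_change Y _ _ Ux cx c'x) sum_ffun1.
apply: eq_bigr => l _; rewrite (sum_ffun0 _ [ffun=> l]).
by rewrite big_ord_recl !big_ord0 !ffunE !mulr1.
Qed.

Lemma endo_change U (A : tensor_field 1 1 U) c c' i j x :
  U x -> mf_dom M c x -> mf_dom M c' x ->
  endo_comp A c' i j x =
  \sum_k \sum_l jac c c' x i k * jac c' c x l j * endo_comp A c k l x.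
Proof.
move=> Ux cx c'x; rewrite /endo_comp (tf_change A _ _ Ux cx c'x) sum_ffun1.
apply: eq_bigr => k _; rewrite sum_ffun1; apply: eq_bigr => l _.
by rewrite !big_ord_recl !big_ord0 !ffunE !mulr1.
Qed.

Lemma vec_comp_C1 U (Y : C1_vector_field U) c k :
  C1_in c U (vec_comp Y c k).
Proof. exact: vf_C1. Qed.

(** The k-th component of the flat derivative of [Y] along [X] in the chart
    [c]. It is not a vector: see [dir_deriv_change]. *)
Definition dir_deriv (X Y : components M 1 0) c k x : R :=
  \sum_m vec_comp X c m x * cderiv c m (vec_comp Y c k) x.

Lemma Lie_vecE (X Y : components M 1 0) c k x :
  vec_comp (Lie X Y) c k x = dir_deriv X Y c k x - dir_deriv Y X c k x.
Proof.
rewrite /vec_comp /Lie big_ord0 addr0 big_ord_recl big_ord0 addr0.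
congr (_ - _); apply: eq_bigr => m _.
rewrite set_index1 ffunE mulrC; congr (Y _ _ _ _ * _); exact: ffun0E.
Qed.

Lemma S_derivation_vecE (S : S_map M) X (Y : components M 1 0) c k x :
  vec_comp (S_derivation S X Y) c k x =
    dir_deriv X Y c k x - dir_deriv Y X c k x +
    \sum_l endo_comp (S X) c k l x * vec_comp Y c l x.
Proof.
rewrite -Lie_vecE {1}/vec_comp /S_derivation /alg_der big_ord0 subr0.
rewrite big_ord_recl big_ord0 addr0; congr (_ + _); apply: eq_bigr => m _.
rewrite set_index1 ffunE; congr (_ * Y _ _ _ _); exact: ffun0E.
Qed.

(** The defect is the second derivative of the change of coordinates, evaluated
    on [X] and [Y]: it comes from differentiating the Jacobian in the law of
    change of [Y]. *)
Lemma dir_deriv_change U U' (X : C1_vector_field U)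
    (Y : C1_vector_field U') c c' k x :
  open U' -> U x -> U' x -> mf_dom M c x -> mf_dom M c' x ->
  dir_deriv X Y c' k x = \sum_l jac c c' x k l * dir_deriv X Y c l x +
    \sum_m \sum_l vec_comp X c m x * cderiv c m (fun z => jac c c' z k l) x
                  * vec_comp Y c l x.
Proof.
move=> oU' Ux U'x cx c'x; have oc' := mf_dom_open (m := M) c'.
have oUc : open (U' `&` mf_dom M c') by exact: openI.
have H m : cderiv c m (vec_comp Y c' k) x =
    \sum_l (cderiv c m (fun z => jac c c' z k l) x * vec_comp Y c l x
            + jac c c' x k l * cderiv c m (vec_comp Y c l) x).
  transitivity (cderiv c m
      (fun z => \sum_l jac c c' z k l * vec_comp Y c l z) x).
    apply: (cderiv_ext m oUc (conj U'x c'x) cx) => z [U'z c'z] cz.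
    exact: vec_change.
  have dJ l := C1_in_diff oc' (jac_C1 c c' k l) c'x cx.
  have dY l := C1_in_diff oU' (vec_comp_C1 Y c l) U'x cx.
  apply: etrans (@pderiv_sum _ _ _ _ xpredT (fun l =>
    (fun z => jac c c' z k l * vec_comp Y c l z) \o mf_inv M c) m _ _) _.
    by move=> l _; apply: differentiableM; [exact: dJ|exact: dY].
  apply: eq_bigr => l _.
  apply: etrans (pderivM m (dJ l) (dY l)) _.
  by rewrite /= mf_coordK.
have E : dir_deriv X Y c' k x =
    \sum_m vec_comp X c m x * cderiv c m (vec_comp Y c' k) x.
  under [RHS]eq_bigr => m _.
    rewrite (cderiv_change m oU' U'x cx c'x (vec_comp_C1 Y c' k)) mulr_sumr.
    over.
  rewrite exchange_big; apply: eq_bigr => a _.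
  rewrite (vec_change X _ Ux cx c'x) mulr_suml; apply: eq_bigr => m _ /=.
  ring.
rewrite E.
under eq_bigr do rewrite H mulr_sumr.
under [X in _ = X + _]eq_bigr do rewrite mulr_sumr.
rewrite [X in _ = X + _]exchange_big -big_split; apply: eq_bigr => m _ /=.
rewrite -big_split; apply: eq_bigr => l _ /=; ring.
Qed.

(** The defects of [dir_deriv X Y] and [dir_deriv Y X] cancel by [jac_sym]. *)
Lemma Lie_change U U' (X : C1_vector_field U)
    (Y : C1_vector_field U') c c' k x :
  open U -> open U' -> U x -> U' x -> mf_dom M c x -> mf_dom M c' x ->
  vec_comp (Lie X Y) c' k x =
  \sum_l jac c c' x k l * vec_comp (Lie X Y) c l x.
Proof.
move=> oU oU' Ux U'x cx c'x.
under [RHS]eq_bigr do rewrite Lie_vecE mulrBr.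
rewrite sumrB Lie_vecE (dir_deriv_change X Y k oU' Ux U'x cx c'x).
rewrite (dir_deriv_change Y X k oU U'x Ux cx c'x).
rewrite opprD addrACA [X in _ + X](_ : _ = 0) ?addr0//.
apply/eqP; rewrite subr_eq0; apply/eqP.
rewrite exchange_big; apply: eq_bigr => l _; apply: eq_bigr => m _ /=.
by rewrite (jac_sym _ _ _ cx c'x) mulrC mulrA mulrAC mulrC mulrA.
Qed.

Lemma S_derivation_change (S : S_map M) (X : C1_vector_field (M := M) setT)
    U (Y : C1_vector_field U) c c' k x :
  open U -> U x -> mf_dom M c x -> mf_dom M c' x ->
  vec_comp (S_derivation S X Y) c' k x =
  \sum_l jac c c' x k l * vec_comp (S_derivation S X Y) c l x.
Proof.
move=> oU Ux cx c'x; have T : [set: M] x by [].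
under [RHS]eq_bigr do rewrite S_derivation_vecE -Lie_vecE mulrDr.
rewrite big_split S_derivation_vecE -Lie_vecE.
rewrite (Lie_change _ _ _ openT oU T Ux cx c'x).
congr (_ + _).
pose A c := \matrix_(i, j) endo_comp (S X) c i j x.
pose v c := \col_i vec_comp Y c i x.
have vE : v c' = jac_mx c c' x *m v c.
  apply/colP => i; rewrite !mxE (vec_change Y i Ux cx c'x).
  by apply: eq_bigr => l _; rewrite !mxE.
have AE : A c' = jac_mx c c' x *m A c *m jac_mx c' c x.
  apply/matrixP => i j; rewrite !mxE (endo_change (S X) i j T cx c'x).
  rewrite exchange_big; apply: eq_bigr => l _; rewrite !mxE mulr_suml.
  apply: eq_bigr => a _; rewrite !mxE; ring.
have AvE d i :
    (A d *m v d) i 0 = \sum_l endo_comp (S X) d i l x * vec_comp Y d l x.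
  by rewrite mxE; apply: eq_bigr => l _; rewrite !mxE.
rewrite -[LHS]AvE vE AE -!mulmxA (mulmxA (jac_mx c' c x)) jac_mxV// mul1mx mxE.
by apply: eq_bigr => l _; rewrite AvE mxE.
Qed.

(** The components in a chart [c] are obtained by the Jacobian of the change
    from [c0], which is defined on all of [U] because [U] lies in the domain of
    [c0]; the cocycle rule makes them compatible. *)
Lemma vector_field_of_chart c0 U (f : 'I_n -> M -> R) :
  open U -> U `<=` mf_dom M c0 -> (forall k, C1_in c0 U (f k)) ->
  exists Y : C1_vector_field U, forall c k x, U x -> mf_dom M c x ->
    vec_comp Y c k x = \sum_l jac c0 c x k l * f l x.
Proof.
move=> oU Uc0 Cf.
pose T : components M 1 0 := fun c x a _ =>
  if `[< (U `&` mf_dom M c) x >]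
  then \sum_l jac c0 c x (a ord0) l * f l x else 0.
have TE c x a b : U x -> mf_dom M c x ->
    T c x a b = \sum_l jac c0 c x (a ord0) l * f l x.
  by move=> Ux cx; rewrite /T; case: asboolP => // -[].
have Tout c x a b : ~ (U `&` mf_dom M c) x -> T c x a b = 0.
  by move=> H; rewrite /T; case: asboolP.
have Tchange c c' x a' b' : U x -> mf_dom M c x -> mf_dom M c' x ->
    T c' x a' b' =
      \sum_(a : {ffun 'I_1 -> 'I_n}) \sum_(b : {ffun 'I_0 -> 'I_n})
        (\prod_s jac c c' x (a' s) (a s)) *
        (\prod_t jac c' c x (b t) (b' t)) * T c x a b.
  move=> Ux cx c'x; rewrite sum_ffun1 TE//.
  under [RHS]eq_bigr => k _.
    rewrite (sum_ffun0 _ b') big_ord_recl !big_ord0 !mulr1 TE//.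
    rewrite !ffunE mulr_sumr.
    over.
  rewrite exchange_big; apply: eq_bigr => l _ /=.
  rewrite (jac_cocycle _ _ (Uc0 _ Ux) cx c'x) mulr_suml; apply: eq_bigr => m _.
  by rewrite mulrA.
have TC1 : is_C1 U T.
  move=> c a b; have oc := mf_dom_open (m := M) c.
  have oUc : open (U `&` mf_dom M c) by exact: openI.
  have : C1_in c ((U `&` mf_dom M c) `&` mf_dom M c0)
      (fun x => \sum_l jac c0 c x (a ord0) l * f l x).
    apply: C1_in_change => //.
    have oI := open_chart_image (c := c0) oUc.
    apply: (@is_C1_sum _ _ _ oI _ _ _ (fun l =>
      (fun x => jac c0 c x (a ord0) l * f l x) \o mf_inv M c0)) => l _.
    apply: (is_C1_M oI).
      have := jac_C1 c0 c (a ord0) l; apply: C1_in_subset; exact: subIsetr.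
    have := Cf l; apply: C1_in_subset; exact: subIsetl.
  rewrite /C1_in; set V := chart_image c _.
  have -> : V = mf_coord M c @` (U `&` mf_dom M c).
    rewrite /V /chart_image; congr (_ @` _).
    apply/seteqP; split=> [x [[[]]]//|x [Ux cx]].
    by split=> //; split=> //; exact: Uc0.
  apply: is_C_ext; first exact: open_chart_image.
  by move=> y /chart_imageP[Uy cy _]; rewrite /= TE.
by exists (C1VectorField (vf_field := TensorField Tout Tchange) TC1) =>
  c k x Ux cx; rewrite /vec_comp /= TE// ffunE.
Qed.

End VectorFields.

(** * A commuting frame with a prescribed derivative at a point *)

Section FrameOfClosedForms.
Variables (R : realType) (n : nat).

(** For a covector [xi] with [xi(X) = 1], the symmetric tensor
    [B^i_lm = (A X)^i xi_l xi_m - xi_l A^i_m - xi_m A^i_l] satisfies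
    [B^i_lm X^m = (A X)^i xi_l - xi_l (A X)^i - A^i_l]. *)
Lemma symmetric_contraction (X : 'I_n -> R) (A : 'M[R]_n) :
  ((forall m, X m = 0) -> A = 0) ->
  exists B : 'I_n -> 'M[R]_n, (forall i l m, B m i l = B l i m) /\
    \sum_m X m *: B m = - A.
Proof.
move=> XA; have [[m Xm]|X0] := pselect (exists m, X m != 0); last first.
  exists (fun=> 0); split=> [i l m|]; first by rewrite !mxE.
  rewrite XA ?oppr0; first by rewrite big1// => m _; rewrite scaler0.
  move=> m; apply/eqP; apply: contrapT => /negP Xm; apply: X0.
  by exists m.
(* the covector is a multiple of a coordinate on which X is not 0 *)
pose xi (l : 'I_n) : R := (l == m)%:R / X m.
have xiX : \sum_l xi l * X l = 1.
  rewrite (bigD1 m)//= big1 ?addr0; first by rewrite /xi eqxx mul1r mulVf.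
  by move=> l /negbTE lm; rewrite /xi lm !mul0r.
pose AX i := \sum_l A i l * X l.
exists (fun m => \matrix_(i, l)
  (AX i * xi l * xi m - xi l * A i m - xi m * A i l)).
split=> [i l k|]; first by rewrite !mxE; ring.
apply/matrixP => i l; rewrite summxE.
transitivity (\sum_k (AX i * xi l * (xi k * X k) - xi l * (A i k * X k)
    - A i l * (xi k * X k))).
  by apply: eq_bigr => k _; rewrite !mxE; ring.
rewrite !sumrB -!mulr_sumr xiX -/(AX i) mxE; ring.
Qed.

Variables (B : 'I_n -> 'M[R]_n) (y0 : 'rV[R]_n).

(** When [B m i l = B l i m], the i-th row is the closed form
    [dy^i - sum_(l, m) (y - y0)^m B^i_lm dy^l]. *)
Definition coframe (y : 'rV[R]_n) : 'M[R]_n :=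
  1%:M - \sum_m (y 0 m - y0 0 m) *: B m.

Lemma coframe_base : coframe y0 = 1%:M.
Proof.
by rewrite /coframe big1 ?subr0// => m _; rewrite subrr scale0r.
Qed.

Lemma coframeE y i j : coframe y i j =
  (1%:M : 'M[R]_n) i j + \sum_m (y 0 m + - y0 0 m) * - B m i j.
Proof.
rewrite /coframe [LHS]mxE [X in _ + X]mxE summxE -sumrN; congr (_ + _).
by apply: eq_bigr => m _; rewrite mxE mulrN.
Qed.

Lemma coframe_C1 V i j : open V -> is_C 1 V (fun y => coframe y i j).
Proof.
move=> oV; apply: (is_C_ext oV (fun y _ => esym (coframeE y i j))).
apply: (is_C1_D oV (is_C1_cst oV _)).
apply: (@is_C1_sum _ _ _ oV _ _ _
  (fun m (y : 'rV[R]_n) => (y 0 m + - y0 0 m) * - B m i j)) => m _.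
apply: (is_C1_M oV); last exact: is_C1_cst.
by apply: (is_C1_D oV); [exact: is_C1_coord|exact: is_C1_cst].
Qed.

Lemma pderiv_coframe k y : pderiv_mx k coframe y = - B k.
Proof.
apply/matrixP => i j; rewrite [LHS]mxE [RHS]mxE.
have d m : differentiable (fun y : 'rV[R]_n => y 0 m + - y0 0 m) y.
  by apply: differentiableD => //; exact: differentiable_coord.
rewrite (_ : (fun z => coframe z i j) = (fun y => (1%:M : 'M[R]_n) i j +
    \sum_m (y 0 m + - y0 0 m) * - B m i j)); last first.
  by apply/funext => z; exact: coframeE.
have ds m :
    differentiable (fun y : 'rV[R]_n => (y 0 m + - y0 0 m) * - B m i j) y.
  exact: differentiableM.
rewrite pderivD //; last exact: differentiable_big_sum.
rewrite pderiv_cst add0r (@pderiv_sum _ _ _ _ _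
  (fun m (y : 'rV[R]_n) => (y 0 m + - y0 0 m) * - B m i j)) //.
rewrite (bigD1 k)//= big1 ?addr0.
  rewrite pderivM// pderivD//; last exact: differentiable_coord.
  by rewrite !pderiv_cst pderiv_coord eqxx mulr0 !addr0 mul1r.
move=> m mk; rewrite pderivM// pderivD//; last exact: differentiable_coord.
by rewrite !pderiv_cst pderiv_coord (negbTE mk) mulr0 !addr0 mul0r.
Qed.

Definition coframe_dom : set 'rV[R]_n := [set y | coframe y \in unitmx].

Lemma open_coframe_dom : open coframe_dom.
Proof.
have oT : open [set: 'rV[R]_n] by exact: openT.
rewrite openE => y uy.
have CD : is_C 1 setT (fun y => \det (coframe y)).
  by apply: is_C1_det => // i j; exact: coframe_C1.
have [cD _] := CD.
have : \forall z \near y, \det (coframe z) != 0.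
  apply: (@cvgr_neq0 R R _ (nbhs y) _ (fun z => \det (coframe z))
    (\det (coframe y))).
    exact: cD.
  by move: uy; rewrite /coframe_dom /= unitmxE unitfE.
by apply: filterS => z; rewrite /coframe_dom /= unitmxE unitfE.
Qed.

(** The j-th column is the j-th vector of the frame dual to the rows of
    [coframe]. *)
Definition frame y : 'M[R]_n := invmx (coframe y).

Lemma frame_C1 V i j : open V -> V `<=` coframe_dom ->
  is_C 1 V (fun y => frame y i j).
Proof.
move=> oV Vd; apply: is_C1_invmx => // i' j'; exact: coframe_C1.
Qed.

(** When [B] is symmetric as above, [frame_a^k * d_k frame_b] is symmetric in
    [a] and [b], i.e. the vectors of the frame commute. *)
Lemma pderiv_frame k y : coframe_dom y ->
  pderiv_mx k frame y = frame y *m B k *m frame y.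
Proof.
move=> dy; rewrite (pderiv_invmx k open_coframe_dom dy) => //.
  by rewrite pderiv_coframe mulmxN mulNmx opprK.
by move=> i j; exact: coframe_C1 open_coframe_dom.
Qed.

End FrameOfClosedForms.

(** * Holonomic bases adapted to a derivation *)

Theorem proposition9 (R : realType) (n : nat) (M : manifold R n)
  (S : S_map M) (X : C1_vector_field (M := M) setT) (x0 : M) :
  (exists E : local_basis M,
     lb_dom E x0 /\ components_vanish_at S X E x0) ->
  exists E : local_basis M,
    [/\ lb_dom E x0, holonomic E & components_vanish_at S X E x0].
Proof.
move=> [E0 [E0x0 [W0 W0P W00]]].
have [c0 c0x0] := mf_cover x0.
pose A := \matrix_(i, j) (endo_comp (S X) c0 i j x0
  - cderiv c0 j (vec_comp X c0 i) x0).
pose X0 m := vec_comp X c0 m x0.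
have DA (Y : components M 1 0) k : vec_comp (S_derivation S X Y) c0 k x0 =
    \sum_m X0 m * cderiv c0 m (vec_comp Y c0 k) x0
    + \sum_j A k j * vec_comp Y c0 j x0.
  rewrite S_derivation_vecE -addrA; congr (_ + _).
  rewrite addrC -sumrB; apply: eq_bigr => j _.
  by rewrite !mxE mulrBl [X in _ - X]mulrC.
(* what the given basis is for: X cannot vanish unless A does *)
have XA : (forall m, X0 m = 0) -> A = 0.
  move=> X00; pose F := \matrix_(i, k) vec_comp (E0 i) c0 k x0.
  have uF : F^T \in unitmx by rewrite unitmx_tr; exact: lb_basis.
  rewrite -(mulmxK uF A) (_ : A *m F^T = 0) ?mul0mx//.
  apply/matrixP => k j; rewrite !mxE.
  have := W0P j c0 k x0 E0x0 c0x0.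
  rewrite DA W00 [X in X + _]big1 ?add0r; last by move=> m _; rewrite X00 mul0r.
  rewrite [X in _ = X]big1; last by move=> i _; rewrite mxE mul0r.
  by move=> H; rewrite -[RHS]H; apply: eq_bigr => i _; rewrite !mxE.
have [B [Bsym BX]] := symmetric_contraction XA.
pose y0 := mf_coord M c0 x0.
pose V := coframe_dom B y0.
have oV : open V by exact: open_coframe_dom.
pose U := mf_dom M c0 `&` [set x | V (mf_coord M c0 x)].
have oU : open U.
  rewrite openE => x [c0x Vx].
  have n1 : nbhs x (mf_dom M c0).
    by apply: open_nbhs_nbhs; split=> //; exact: mf_dom_open.
  have n2 : \forall z \near x, V (mf_coord M c0 z).
    by apply: (mf_coord_continuous c0x); exact: open_nbhs_nbhs.
  exact: filterI n1 n2.
have Uc0 : U `<=` mf_dom M c0 by move=> x [].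
have UV x : U x -> V (mf_coord M c0 x) by move=> [].
have iV : chart_image c0 U `<=` V by move=> _ [x [/UV Vx _] <-].
pose f j k x := frame B y0 (mf_coord M c0 x) k j.
have fC1 j k : C1_in c0 U (f j k).
  apply: is_C_ext (frame_C1 k j (open_chart_image oU) iV).
    exact: open_chart_image.
  by move=> y /chart_imageP[_ _ yE]; rewrite /= /f yE.
have /choice[E EP] : forall j, exists Y : C1_vector_field U,
    forall c k x, U x -> mf_dom M c x ->
      vec_comp Y c k x = \sum_l jac c0 c x k l * f j l x.
  by move=> j; exact: vector_field_of_chart.
have E0P j k x : U x -> vec_comp (E j) c0 k x = f j k x.
  move=> Ux; have c0x := Uc0 x Ux.
  rewrite EP// (bigD1 k)//= jac_id// eqxx mul1r.
  by rewrite big1 ?addr0// => l /negbTE lk; rewrite jac_id// eq_sym lk mul0r.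
have dE j k m x : U x -> cderiv c0 m (vec_comp (E j) c0 k) x =
    (frame B y0 (mf_coord M c0 x) *m B m *m frame B y0 (mf_coord M c0 x)) k j.
  move=> Ux; rewrite -(pderiv_frame _ (UV x Ux)) mxE.
  apply: (eq_open_pderiv _ (open_chart_image oU)
    (mem_chart_image Ux (Uc0 x Ux))).
  by move=> y /chart_imageP[Uy _ yE]; rewrite /= E0P// /f yE.
have Ebasis c x : U x -> mf_dom M c x ->
    \matrix_(i, k) vec_comp (E i) c k x \in unitmx.
  move=> Ux cx; rewrite -unitmx_tr.
  rewrite (_ : _^T = jac_mx c0 c x *m frame B y0 (mf_coord M c0 x)).
    rewrite unitmx_mul /frame unitmx_inv; apply/andP; split; last exact: UV.
    have := jac_mxV (Uc0 x Ux) cx => /mulmx1_unit[_]; exact.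
  apply/matrixP => k i; rewrite !mxE EP//.
  by apply: eq_bigr => l _; rewrite mxE.
pose LB := LocalBasis oU Ebasis.
have Ux0 : U x0.
  by split=> //; rewrite /V /coframe_dom /= coframe_base unitmx1.
exists LB; split=> //.
- move=> i j c k x /= Ux cx.
  rewrite (Lie_change (E i) (E j) k oU oU Ux Ux (Uc0 x Ux) cx).
  apply: big1 => l _; rewrite Lie_vecE [_ - _](_ : _ = 0) ?mulr0//.
  apply/eqP; rewrite subr_eq0; apply/eqP.
  set F := frame B y0 (mf_coord M c0 x).
  have D a b : dir_deriv (E a) (E b) c0 l x =
      \sum_m \sum_p \sum_q F m a * F l q * B m q p * F p b.
    apply: eq_bigr => m _; rewrite E0P// dE// mxE mulr_sumr.
    apply: eq_bigr => p _; rewrite mxE mulr_suml mulr_sumr.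
    by apply: eq_bigr => q _; rewrite /f !mulrA.
  rewrite !D exchange_big; apply: eq_bigr => m _; apply: eq_bigr => p _.
  by apply: eq_bigr => q _; rewrite (Bsym q p m); ring.
(* the matrix of components is the value of D_X on the frame, expressed in
   the frame itself by means of the dual forms *)
- pose D x := \matrix_(i, j) vec_comp (S_derivation S X (E j)) c0 i x.
  exists (fun x => coframe B y0 (mf_coord M c0 x) *m D x).
    move=> j c k x /= Ux cx.
    rewrite (S_derivation_change S X (E j) k oU Ux (Uc0 x Ux) cx).
    set G := coframe _ _ _; have uG : G \in unitmx := UV x Ux.
    have DE : D x = invmx G *m (G *m D x) by rewrite mulKmx.
    under [RHS]eq_bigr do rewrite EP// mulr_sumr.
    rewrite exchange_big; apply: eq_bigr => l _.
    transitivity (jac c0 c x k l * D x l j); first by rewrite mxE.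
    rewrite [in LHS]DE mxE mulr_sumr; apply: eq_bigr => i _.
    by rewrite /f /frame -/G [LHS]mulrA; exact: mulrC.
  rewrite -/y0 coframe_base mul1mx; apply/matrixP => k j.
  rewrite !mxE DA.
  have F1 : frame B y0 y0 = 1%:M by rewrite /frame coframe_base invmx1.
  rewrite [X in X + _](_ : _ = (\sum_m X0 m *: B m) k j); last first.
    rewrite summxE; apply: eq_bigr => m _; rewrite dE// -/y0 F1 mul1mx mulmx1.
    by rewrite [RHS]mxE.
  rewrite BX mxE [X in _ + X](_ : _ = (A *m 1%:M) k j).
    by rewrite mulmx1 addNr.
  by rewrite [RHS]mxE; apply: eq_bigr => l _; rewrite E0P// /f -/y0 F1.
Qed.
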